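(* There do not exist a constant $C>0$ and a function $g:\{0,1,2,\ldots\}\to(0,\infty)$ satisfying $g(r)=o(r)$ as $r\to\infty$ such that $$\mathcal{M}(A)\le C\,g\bigl(\min\{\operatorname{ind}_-(J),\operatorname{ind}_+(J)\}\bigr)\,\mathcal{K}(A)$$ for every fundamental symmetry $J$ (of any size $n\ge1$) and every $J$-selfadjoint matrix $A\in\mathbb{C}^{n\times n}$ with $\sigma(A)\subset\{z\in\mathbb{C}:|z|\le1\}$.
   Context: A fundamental symmetry is a matrix $J\in\mathbb{C}^{n\times n}$ with $J=J^*=J^{-1}$; $\operatorname{ind}_-(J)$ and $\operatorname{ind}_+(J)$ are the numbers of its eigenvalues equal to $-1$ and $1$, respectively, counted with multiplicity. A matrix $A$ is $J$-selfadjoint if $A^*J=JA$. $\sigma(A)$ is the spectrum of $A$ and $\|\cdot\|_2$ is the spectral norm. For $A$ with spectrum in the closed unit disk, $\mathcal{M}(A):=\sup_{k\ge0}\|A^k\|_2$ and $\mathcal{K}(A):=\sup_{|z|>1}(|z|-1)\|(zI-A)^{-1}\|_2$; either may equal $+\infty$, and inequalities are understood in the extended sense. *)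

(* Defs.v *)
From mathcomp Require Export all_boot all_order all_algebra.
From mathcomp Require Export complex.
From mathcomp Require Export all_classical all_reals all_analysis.
Export Order.TTheory GRing.Theory Num.Theory.
Export numFieldNormedType.Exports.
Export ComplexField.Normc.

Set Implicit Arguments.
Unset Strict Implicit.
Unset Printing Implicit Defensive.

Local Open Scope complex_scope.
Local Open Scope classical_set_scope.
Local Open Scope sesquilinear_scope.
Local Open Scope ring_scope.

(* [invmx J] is [J] itself when [J] is singular, so invertibility has to be
   required separately. *)
Definition fundamental_symmetry (R : realType) (n : nat) (J : 'M[R[i]]_n) :=
  [/\ J \in unitmx, J = J^t* & J = invmx J].

Definition J_selfadjoint (R : realType) (n : nat) (J A : 'M[R[i]]_n) :=
  A^t* *m J = J *m A.

Definition ind_neg (R : realType) (n : nat) (J : 'M[R[i]]_n) : nat :=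
  mup (-1) (char_poly J).

Definition ind_pos (R : realType) (n : nat) (J : 'M[R[i]]_n) : nat :=
  mup 1 (char_poly J).

Definition norm2 (R : realType) (n : nat) (x : 'cV[R[i]]_n) : R :=
  Num.sqrt (\sum_(i < n) normc (x i 0) ^+ 2).

(* The set is nonempty and bounded above, so this real [sup] is a genuine
   supremum. *)
Definition spectral_norm (R : realType) (n : nat) (A : 'M[R[i]]_n) : R :=
  sup [set norm2 (A *m x) | x in [set x : 'cV[R[i]]_n | norm2 x <= 1]].

Definition spectrum (R : realType) (n : nat) (A : 'M[R[i]]_n) : set R[i] :=
  [set z | eigenvalue A z].

Definition power_constant (R : realType) (n : nat) (A : 'M[R[i]]_n) : \bar R :=
  ereal_sup [set (spectral_norm (A ^+ k))%:E | k in [set: nat]].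

(* Meant for [A] with spectrum in the closed unit disk: then [z%:M - A] is
   invertible whenever [1 < normc z]. *)
Definition kreiss_constant (R : realType) (n : nat) (A : 'M[R[i]]_n) : \bar R :=
  ereal_sup [set ((normc z - 1) * spectral_norm (invmx (z%:M - A)))%:E
            | z in [set z : R[i] | 1 < normc z]].

(* Main.v *)
(* Let N be the nilpotent n x n shift, n = 2 r, and A = c N. The reversal matrix
   J is a fundamental symmetry with both indices equal to r, and A is
   J-selfadjoint because it is real and Toeplitz. Clearly M(A) >= c^(n-1). In
   the resolvent sum_(k < n) c^k N^k / z^(k+1) each term contributes at most
   c^k / (k+1) to K(A), since (t - 1) / t^(k+1) <= 1 / (k+1) for t > 1 by
   Bernoulli. Taking c = n + 1 makes the last term dominate, so that
   K(A) <= 2 c^(n-1) / n, and the inequality in question forces r <= C g(r). *)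
Require Import Defs.
From mathcomp Require Import ring lra zify.

Set Implicit Arguments.
Unset Strict Implicit.
Unset Printing Implicit Defensive.

Local Open Scope complex_scope.
Local Open Scope classical_set_scope.
Local Open Scope ring_scope.

(** * The reversal matrix and its inertia *)

Section Flip.
Variable K : fieldType.

(** The columns of the block matrix (1; F) are fixed by the swap, so the unipotent [L] conjugates
    the characteristic matrix into the block triangular [T], whose diagonal blocks are the scalars X
    - 1 and X + 1. *)
Lemma char_poly_swap (r : nat) (F : 'M[K]_r) : F *m F = 1%:M ->
  char_poly (block_mx 0 F F 0) = ('X - 1%:P) ^+ r * ('X - (- 1)%:P) ^+ r.
Proof.
move=> FF; rewrite /char_poly /char_poly_mx.
set G := map_mx polyC F.
have GG : G *m G = 1%:M by rewrite -map_mxM FF map_scalar_mx rmorph1.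
set M := (X in \det X).
set L : 'M[{poly K}]_(r + r) := block_mx 1%:M 0 G 1%:M.
set T : 'M[{poly K}]_(r + r) :=
  block_mx ('X - 1%:P)%:M (- G) 0 ('X - (- 1)%:P)%:M.
have detL : \det L = 1 by rewrite det_lblock !det1 mul1r.
have ML : M *m L = L *m T.
  rewrite /M map_block_mx scalar_mx_block !map_mx0 opp_block_mx add_block_mx.
  rewrite !mulmx_block -/G !(oppr0, addr0, add0r, mulmx0, mul0mx, mulmx1, mul1mx).
  rewrite mulNmx mulmxN GG polyCN opprK !raddfB !raddfD /= !polyC1.
  by rewrite mulmx1 scalar_mxC (addrC (- G)) (addrC (- 1%:M)) addrK.
have := congr1 (fun B => \det B) ML.
by rewrite !det_mulmx detL mulr1 mul1r det_ublock !det_scalar => ->.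
Qed.

Definition flip_mx (n : nat) : 'M[K]_n := \matrix_(i, j) (j == rev_ord i)%:R.

Lemma mul_flip_mx (m n : nat) (A : 'M[K]_(m, n)) i j :
  (flip_mx m *m A) i j = A (rev_ord i) j.
Proof.
rewrite mxE (bigD1 (rev_ord i)) //= mxE eqxx mul1r big1 ?addr0 // => k nk.
by rewrite mxE (negPf nk) mul0r.
Qed.

Lemma tr_flip_mx (n : nat) : (flip_mx n)^T = flip_mx n.
Proof.
by apply/matrixP=> i j; rewrite !mxE -(inj_eq rev_ord_inj) rev_ordK eq_sym.
Qed.

Lemma mul_mx_flip (m n : nat) (A : 'M[K]_(m, n)) i j :
  (A *m flip_mx n) i j = A i (rev_ord j).
Proof.
by rewrite -(trmxK (A *m _)) trmx_mul tr_flip_mx mxE mul_flip_mx mxE.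
Qed.

Lemma flip_mxK (n : nat) : flip_mx n *m flip_mx n = 1%:M.
Proof.
by apply/matrixP=> i j; rewrite mul_flip_mx !mxE rev_ordK eq_sym.
Qed.

Lemma flip_mx_block (r : nat) :
  flip_mx (r + r) = block_mx 0 (flip_mx r) (flip_mx r) 0.
Proof.
apply/matrixP=> i j; rewrite -(fintype.splitK i) -(fintype.splitK j).
case: (fintype.split i) => a; case: (fintype.split j) => b /=;
rewrite ?(block_mxEul, block_mxEur, block_mxEdl, block_mxEdr) !mxE;
rewrite -!val_eqE /=; have := ltn_ord a; have := ltn_ord b => bn an;
(* Off the diagonal both sides are indicators of equivalent index equations; in a diagonal block the
   equation has no solution. *)
first [apply: (congr1 (fun c : bool => c%:R : K))
      | rewrite (_ : _ == _ = false) //]; lia.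
Qed.

End Flip.
Arguments flip_mx {K n}.

Lemma fundamental_symmetry_flip (R : realType) (n : nat) :
  fundamental_symmetry (flip_mx : 'M[R[i]]_n).
Proof.
have FU : (flip_mx : 'M[R[i]]_n) \in unitmx.
  by have [] := mulmx1_unit (flip_mxK R[i] n).
split=> //.
  by apply/matrixP=> i j; rewrite -[in LHS]tr_flip_mx !mxE rmorph_nat.
by rewrite -[LHS]mulmx1 -(mulmxV FU) mulmxA flip_mxK mul1mx.
Qed.

Lemma mup_prod_XsubC (K : fieldType) (x y : K) (r s : nat) : x != y ->
  mup x (('X - x%:P) ^+ r * ('X - y%:P) ^+ s) = r.
Proof.
move=> xy; rewrite mupM ?expf_neq0 ?polyXsubC_eq0 //.
by rewrite !mup_XsubCX eqxx eq_sym (negPf xy) addn0.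
Qed.

Lemma oppr1_neq1 (R : realType) : (- 1 : R[i]) != 1.
Proof. by rewrite eq_sym -subr_eq0 opprK (pnatr_eq0 _ 2). Qed.

Lemma ind_flip (R : realType) (r : nat) :
  ind_neg (flip_mx : 'M[R[i]]_(r + r)) = r /\
  ind_pos (flip_mx : 'M[R[i]]_(r + r)) = r.
Proof.
rewrite /ind_neg /ind_pos flip_mx_block char_poly_swap ?flip_mxK //.
split; last by rewrite mup_prod_XsubC // eq_sym oppr1_neq1.
by rewrite mulrC mup_prod_XsubC // oppr1_neq1.
Qed.

(** * Euclidean norm and spectral norm *)

Section Norm.
Variable R : realType.
Local Notation C := R[i].

Lemma normc_ge0 (z : C) : 0 <= normc z.
Proof. by case: z => a b; exact: sqrtr_ge0. Qed.

Lemma normc_real (a : R) : normc a%:C = `|a|.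
Proof. by rewrite /= expr0n addr0 sqrtr_sqr. Qed.

Lemma normcX (z : C) k : normc (z ^+ k) = normc z ^+ k.
Proof. by elim: k => [|k IH]; rewrite ?normc1 // !exprS normcM IH. Qed.

Section Fixed_dim.
Variable n : nat.
Implicit Types x y : 'cV[C]_n.

Lemma norm2_ge0 x : 0 <= norm2 x.
Proof. exact: sqrtr_ge0. Qed.

Lemma sqr_norm2 x : norm2 x ^+ 2 = \sum_(i < n) normc (x i 0) ^+ 2.
Proof.
by rewrite sqr_sqrtr // sumr_ge0 // => i _; rewrite exprn_ge0 ?normc_ge0.
Qed.

Lemma norm20 : norm2 (0 : 'cV[C]_n) = 0.
Proof.
rewrite /norm2 big1 ?sqrtr0 // => i _.
by rewrite mxE normc0 expr0n.
Qed.

Lemma normc_le_norm2 x i : normc (x i 0) <= norm2 x.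
Proof.
rewrite -ler_sqr ?nnegrE ?norm2_ge0 ?normc_ge0 // sqr_norm2 (bigD1 i) //=.
by rewrite lerDl sumr_ge0 // => j _; rewrite exprn_ge0 ?normc_ge0.
Qed.

Lemma norm2_eq0 x : norm2 x = 0 -> x = 0.
Proof.
move=> x0; apply/matrixP=> i j; rewrite (ord1 j) mxE; apply: eq0_normc.
by apply/le_anti; rewrite normc_ge0 andbT -x0 normc_le_norm2.
Qed.

Lemma norm2Z (a : C) x : norm2 (a *: x) = normc a * norm2 x.
Proof.
apply/eqP; rewrite -(eqrXn2 (_ : 0 < 2)%N) ?mulr_ge0 ?norm2_ge0 ?normc_ge0 //.
rewrite exprMn !sqr_norm2 mulr_sumr; apply/eqP/eq_bigr=> i _.
by rewrite mxE normcM exprMn.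
Qed.

(* Convexity of the square, in the form (a + b)^2 <= (s + t) (a^2/s + b^2/t)
   with s and t the two norms, replaces Cauchy-Schwarz. *)
Lemma norm2D x y : norm2 (x + y) <= norm2 x + norm2 y.
Proof.
have [x0|xn0] := eqVneq (norm2 x) 0.
  by rewrite (norm2_eq0 x0) norm20 !add0r.
have [y0|yn0] := eqVneq (norm2 y) 0.
  by rewrite (norm2_eq0 y0) norm20 !addr0.
have s0 : 0 < norm2 x by rewrite lt0r xn0 norm2_ge0.
have t0 : 0 < norm2 y by rewrite lt0r yn0 norm2_ge0.
rewrite -ler_sqr ?nnegrE ?addr_ge0 ?norm2_ge0 // sqr_norm2.
have -> : (norm2 x + norm2 y) ^+ 2 = \sum_(i < n) (norm2 x + norm2 y) *
    (normc (x i 0) ^+ 2 / norm2 x + normc (y i 0) ^+ 2 / norm2 y).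
  rewrite -mulr_sumr big_split /= -!mulr_suml -!sqr_norm2 !expr2.
  by rewrite !mulfK.
apply: ler_sum => i _; rewrite mxE.
apply: (@le_trans _ _ ((normc (x i 0) + normc (y i 0)) ^+ 2)).
  by rewrite ler_sqr ?nnegrE ?addr_ge0 ?normc_ge0 // le_normcD.
move: (norm2 x) (norm2 y) (normc (x i 0)) (normc (y i 0)) s0 t0.
move=> s t a b s0 t0.
rewrite -subr_ge0.
have -> : (s + t) * (a ^+ 2 / s + b ^+ 2 / t) - (a + b) ^+ 2 =
          (t * a - s * b) ^+ 2 / (s * t).
  by field; rewrite !gt_eqF.
by rewrite divr_ge0 ?sqr_ge0 ?mulr_ge0 ?ltW.
Qed.

Lemma norm2_sum m (x : 'I_m -> 'cV[C]_n) :
  norm2 (\sum_(k < m) x k) <= \sum_(k < m) norm2 (x k).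
Proof.
elim/big_ind2: _ => // [|u s v t us vt]; first by rewrite norm20.
by rewrite (le_trans (norm2D _ _)) // lerD.
Qed.

Section Bounded.
Variables (A : 'M[C]_n) (c : R).
Hypothesis A_le : forall x, norm2 (A *m x) <= c * norm2 x.
Hypothesis c_ge0 : 0 <= c.

(** A real [sup] dominates its set only if the set is bounded above; the estimate [A_le], with any
    constant [c], supplies this. *)
Let unit_image_ubound :
  ubound [set norm2 (A *m x) | x in [set x : 'cV[C]_n | norm2 x <= 1]] c.
Proof.
move=> _ [x /= x1 <-]; apply: le_trans (A_le x) _.
by rewrite -[leRHS]mulr1 ler_wpM2l.
Qed.

Lemma spectral_norm_le : spectral_norm A <= c.
Proof.
apply: ge_sup => //; exists (norm2 (A *m 0)), 0 => //=.
by rewrite norm20.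
Qed.

Lemma le_spectral_norm x : norm2 x <= 1 -> norm2 (A *m x) <= spectral_norm A.
Proof. by move=> x1; apply: ub_le_sup; [exists c | exists x]. Qed.

End Bounded.
End Fixed_dim.

(** * The weighted shift and its powers *)

Definition shift_mx (c : R) (n : nat) : 'M[C]_n :=
  \matrix_(i, j) (c%:C *+ (j == i.+1 :> nat)).

Lemma J_selfadjoint_shift (c : R) (n : nat) :
  J_selfadjoint flip_mx (shift_mx c n).
Proof.
apply/matrixP=> i j; rewrite mul_flip_mx mul_mx_flip !mxE.
rewrite rmorphMn; congr (_ *+ _); first exact: conjc_real.
(* Both conditions say i + j = n. *)
by congr nat_of_bool; rewrite /=; have := ltn_ord i; have := ltn_ord j; lia.
Qed.

Lemma shift_mxX (c : R) (n k : nat) :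
  shift_mx c n ^+ k = \matrix_(i, j) ((c ^+ k)%:C *+ (j == (i + k)%N :> nat)).
Proof.
elim: k => [|k IH]; apply/matrixP => i j.
  by rewrite expr0 !mxE addn0 eq_sym.
rewrite exprS IH mxE mxE.
(* Row [i] of the shift can only have an entry in column [i.+1]; for the last row that column is
   missing. *)
have [iln|nli] := ltnP i.+1 n.
  rewrite (bigD1 (Ordinal iln)) //= big1 ?addr0 => [|l /eqP nl].
    by rewrite !mxE /= eqxx mulr1n mulrnAr exprS rmorphM /= addSnnS.
  rewrite !mxE (_ : (l == i.+1 :> nat) = false) ?mul0r //.
  by apply/eqP => e; apply: nl; apply: val_inj.
rewrite big1 => [|l _].
  by rewrite (_ : (j == _ :> nat) = false) //; have := ltn_ord j; lia.
rewrite !mxE (_ : (l == i.+1 :> nat) = false) ?mul0r //.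
by have := ltn_ord l; lia.
Qed.

Lemma shift_mx_nilp (c : R) (n : nat) : shift_mx c n ^+ n = 0.
Proof.
apply/matrixP=> i j; rewrite shift_mxX !mxE (_ : (j == _ :> nat) = false) //.
by have := ltn_ord j; lia.
Qed.

Lemma norm2_shift (c : R) (n : nat) (x : 'cV[C]_n) : 0 <= c ->
  norm2 (shift_mx c n *m x) <= c * norm2 x.
Proof.
move=> c0; rewrite -ler_sqr ?nnegrE ?mulr_ge0 ?norm2_ge0 // exprMn !sqr_norm2.
case: n x => [|n] x; first by rewrite !big_ord0 mulr0.
(* The last coordinate of the image is zero and the first coordinate of [x] is lost; the remaining
   terms agree one by one. *)
rewrite big_ord_recr big_ord_recl /= [X in _ + X](_ : _ = 0) ?addr0.
  rewrite mulrDr mulr_sumr ler_wpDl ?mulr_ge0 ?exprn_ge0 ?normc_ge0 //.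
  apply: ler_sum => i _; rewrite -exprMn mxE (bigD1 (lift ord0 i)) //= big1.
    by rewrite mxE /= eqxx addr0 normcM normc_real ger0_norm.
  move=> l nl; rewrite mxE (_ : (l == _ :> nat) = false) ?mul0r //.
  by apply: contraNF nl => /eqP e; apply/eqP/val_inj.
rewrite mxE big1 ?normc0 ?expr0n // => l _.
rewrite mxE (_ : (l == _ :> nat) = false) ?mul0r //=.
by have := ltn_ord l; lia.
Qed.

Lemma norm2_shiftX (c : R) (n k : nat) (x : 'cV[C]_n) : 0 <= c ->
  norm2 (shift_mx c n ^+ k *m x) <= c ^+ k * norm2 x.
Proof.
move=> c0; elim: k => [|k IH]; first by rewrite !expr0 mul1mx mul1r.
rewrite !exprS -mulrA -[_ * _ ^+ k]/(_ *m _) -mulmxA.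
by rewrite (le_trans (norm2_shift _ c0)) // ler_wpM2l.
Qed.

(** * Spectrum and resolvent of a nilpotent matrix *)

Lemma spectrum_nilp n (A : 'M[C]_n) : A ^+ n = 0 ->
  spectrum A `<=` [set z | normc z <= 1].
Proof.
move=> An z /eigenvalueP[v vA v0] /=.
have vX k : v *m A ^+ k = z ^+ k *: v.
  elim: k => [|k IH]; first by rewrite !expr0 mulmx1 scale1r.
  by rewrite !exprSr -[_ ^+ k * A]/(_ *m _) mulmxA IH -scalemxAl vA scalerA.
have /esym/eqP := vX n; rewrite An mulmx0 scaler_eq0 (negPf v0) orbF.
by rewrite expf_eq0 => /andP[_ /eqP ->]; rewrite normc0.
Qed.

(** The partial Neumann sums telescope, and at [m = n] the remainder vanishes. The resulting product
    1 also proves [z%:M - A] invertible, so that [invmx] is a true inverse. *)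
Lemma invmx_resolvent_nilp n (A : 'M[C]_n) z : A ^+ n = 0 -> z != 0 ->
  invmx (z%:M - A) = \sum_(k < n) z ^- k.+1 *: A ^+ k.
Proof.
move=> An z0.
have tele m : (z%:M - A) *m (\sum_(k < m) z ^- k.+1 *: A ^+ k) =
              1%:M - z ^- m *: A ^+ m.
  elim: m => [|m IH].
    by rewrite big_ord0 mulmx0 !expr0 invr1 scale1r subrr.
  rewrite big_ord_recr /= mulmxDr IH mulmxBl mul_scalar_mx scalerA.
  rewrite -scalemxAr -[A *m _]/(_ * _) -exprS [z ^+ m.+1]exprS invfM mulrA.
  by rewrite divff // mul1r addrA subrK.
have := tele n; rewrite An scaler0 subr0 => inv.
have [U _] := mulmx1_unit inv.
by rewrite -[LHS]mulmx1 -inv mulmxA mulVmx // mul1mx.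
Qed.

(** * Kreiss and power constants of the shift *)

Lemma bernoulli_le (t : R) k : 1 <= t -> (t - 1) / t ^+ k.+1 <= k.+1%:R^-1.
Proof.
move=> t1; have tk j : 1 + j%:R * (t - 1) <= t ^+ j.
  elim: j => [|j IH]; first by rewrite mul0r addr0 expr0.
  rewrite exprS; apply: le_trans (ler_wpM2l _ IH); last by lra.
  rewrite -subr_ge0 -natr1.
  have -> : t * (1 + j%:R * (t - 1)) - (1 + (j%:R + 1) * (t - 1)) =
            j%:R * (t - 1) ^+ 2 by ring.
  by rewrite mulr_ge0 ?sqr_ge0.
rewrite ler_pdivrMr ?exprn_gt0 //; last by lra.
rewrite mulrC ler_pdivlMr ?ltr0n // mulrC.
by apply: le_trans (tk k.+1); lra.
Qed.

Lemma kreiss_shift (c : R) (n : nat) : 0 <= c ->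
  (kreiss_constant (shift_mx c n) <= (\sum_(k < n) c ^+ k / k.+1%:R)%:E)%E.
Proof.
move=> c0; apply: ge_ereal_sup => _ [z /= z1 <-]; rewrite lee_fin.
have z0 : z != 0 by apply: contraTneq z1 => ->; rewrite normc0 ltr10.
rewrite (invmx_resolvent_nilp (shift_mx_nilp _ _) z0).
have S0 : 0 <= \sum_(k < n) c ^+ k / normc z ^+ k.+1.
  by apply: sumr_ge0 => k _; rewrite divr_ge0 ?exprn_ge0 ?normc_ge0.
apply: (@le_trans _ _
    ((normc z - 1) * \sum_(k < n) c ^+ k / normc z ^+ k.+1)).
  rewrite ler_wpM2l ?subr_ge0 ?(ltW z1) // spectral_norm_le // => x.
  rewrite mulmx_suml (le_trans (norm2_sum _)) // mulr_suml.
  apply: ler_sum => k _; rewrite -scalemxAl norm2Z normcV normcX.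
  rewrite [leRHS]mulrAC [leRHS]mulrC ler_wpM2l ?invr_ge0 ?exprn_ge0 ?normc_ge0 //.
  exact: norm2_shiftX.
rewrite mulr_sumr; apply: ler_sum => k _.
by rewrite mulrCA ler_wpM2l ?exprn_ge0 // bernoulli_le // ltW.
Qed.

Lemma power_shift (c : R) (m : nat) : 0 <= c ->
  ((c ^+ m)%:E <= power_constant (shift_mx c m.+1))%E.
Proof.
move=> c0.
apply: (@le_trans _ _ (spectral_norm (shift_mx c m.+1 ^+ m))%:E); last first.
  by apply: ereal_sup_ubound; exists m.
rewrite lee_fin.
(* The power [m] has its only entry in the top right corner: it sends the last basis vector to c^m
   times the first. *)
pose e : 'cV[C]_m.+1 := delta_mx ord_max 0.
have e1 : norm2 e <= 1.
  rewrite -ler_sqr ?nnegrE ?norm2_ge0 // sqr_norm2 (bigD1 ord_max) //= big1.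
    by rewrite addr0 mxE !eqxx normc1.
  by move=> i /negPf ni; rewrite mxE ni normc0 expr0n.
have cm0 : 0 <= c ^+ m by rewrite exprn_ge0.
apply: le_trans (le_spectral_norm (fun x => norm2_shiftX _ x c0) cm0 e1).
apply: le_trans (normc_le_norm2 _ ord0).
rewrite -colE mxE shift_mxX mxE add0n eqxx mulr1n normc_real.
by rewrite ler_norm.
Qed.

(** With c = m + 2 one has c - 1 = m + 1, so the terms before the last, stripped of their divisors,
    form a geometric sum equal to (c^m - 1) / (m + 1). This is below the last term, hence the factor
    2. *)
Lemma kreiss_shift_large (m : nat) :
  (kreiss_constant (shift_mx m.+2%:R m.+1) <=
     (2 * m.+2%:R ^+ m / m.+1%:R)%:E)%E.
Proof.
set c : R := m.+2%:R; have c0 : 0 <= c by rewrite ler0n.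
apply: le_trans (kreiss_shift _ c0) _; rewrite lee_fin big_ord_recr /=.
rewrite mulrDl mul1r mulrDl lerD2r.
apply: (@le_trans _ _ (\sum_(k < m) c ^+ k)).
  apply: ler_sum => k _; rewrite ler_piMr ?exprn_ge0 //.
  by rewrite invf_le1 ?ltr0n // ler1n.
rewrite ler_pdivlMr ?ltr0n // mulrC.
have -> : m.+1%:R = c - 1 by rewrite /c -[in RHS]natr1 addrK.
by rewrite -subrX1 lerBlDr lerDl.
Qed.

End Norm.

(** * Linear growth of [g] against the little-o hypothesis *)

Theorem corollary5p2 (R : realType) :
  ~ exists (C : R) (g : nat -> R),
      [/\ 0 < C,
          forall r : nat, 0 < g r,
          g =o_\oo (fun r : nat => r%:R : R) &
          forall (n : nat) (J A : 'M[R[i]]_n),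
            (0 < n)%N ->
            fundamental_symmetry J ->
            J_selfadjoint J A ->
            spectrum A `<=` [set z | normc z <= 1] ->
            (power_constant A <=
               (C * g (minn (ind_neg J) (ind_pos J)))%:E * kreiss_constant A)%E].
Proof.
move=> [C [g [C0 g0 go bound]]].
have growth s : s.+1%:R <= C * g s.+1.
  (* The size [m.+1] is convertible to [s.+1 + s.+1], where [ind_flip] makes both indices [s.+1]. *)
  pose m := (s + s.+1)%N; pose c : R := m.+2%:R.
  have [neg pos] := ind_flip R s.+1.
  have := bound m.+1 flip_mx (shift_mx c m.+1) isT
    (fundamental_symmetry_flip _ _) (J_selfadjoint_shift _ _)
    (spectrum_nilp (shift_mx_nilp _ _)).
  rewrite neg pos minnn => /(le_trans (power_shift _ (ler0n _ _))) le1.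
  have Cg : 0 < C * g s.+1 by rewrite mulr_gt0.
  have := le_trans le1 (lee_wpmul2l _ (kreiss_shift_large R m)).
  rewrite -EFinM !lee_fin => /(_ (ltW Cg)); rewrite -/c.
  have cm : 0 < c ^+ m by rewrite exprn_gt0 // ltr0n.
  (* The 2 of the Kreiss bound cancels against m + 1 = 2 (s + 1); then c^m cancels from both
     sides. *)
  have -> : C * g s.+1 * (2 * c ^+ m / m.+1%:R) =
            C * g s.+1 / s.+1%:R * c ^+ m.
    have -> : m.+1%:R = 2 * s.+1%:R :> R by rewrite -natrM; congr _%:R; lia.
    by field; rewrite nat1r pnatr_eq0.
  by rewrite ler_pMl // ler_pdivlMr ?ltr0n // mul1r.
(* With this epsilon, C g(N + 1) is at most (N + 1) / 2, while [growth] makes it at least N + 1,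
   which is positive. *)
have /eqoP/(_ (2 * C)^-1) := go.
rewrite invr_gt0 mulr_gt0 // => /(_ isT) [N _ /(_ N.+1 (leqnSn N))] /=.
rewrite !ger0_norm ?(ltW (g0 _)) // => le1.
have /(ler_wpM2l (ltW C0)) := le1.
have := growth N; have : (0 : R) < N.+1%:R by rewrite ltr0n.
have -> : C * ((2 * C)^-1 * N.+1%:R) = N.+1%:R / 2 by field; rewrite gt_eqF.
lra.
Qed.
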